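(* Let $A\in\mathbb{C}^{n\times n}$ have no eigenvalues on the closed negative real axis $\mathbb{R}_0^-=(-\infty,0]$ and let $B\in\mathbb{C}^{n\times n}$ be any square complex matrix. Then the following properties hold: (i) $A^B$ and ${}^{B}\!A$ have the same spectra. (ii) If $A$ and $B$ commute, and have spectra $\sigma(A)=\{\alpha_1,\ldots,\alpha_n\}$ and $\sigma(B)=\{\beta_1,\ldots,\beta_n\}$, then the spectrum of $A^B$ (or of ${}^{B}\!A$) is given by $\{\alpha_{i_1}^{\beta_{j_1}},\ldots,\alpha_{i_n}^{\beta_{j_n}}\}$ for some permutations $\{i_1,\ldots,i_n\}$ and $\{j_1,\ldots,j_n\}$ of the set $\{1,\ldots,n\}$. (iii) $B\,A^B={}^{B}\!A\,B$.
   Context: $e^X$ is the matrix exponential. For $A\in\mathbb{C}^{n\times n}$ with no eigenvalues on $\mathbb{R}_0^-=(-\infty,0]$, $\log(A)$ denotes the principal logarithm, i.e. the unique solution $X$ of $e^X=A$ all of whose eigenvalues lie in the open strip $\{z\in\mathbb{C}:-\pi<\operatorname{Im} z<\pi\}$. The two matrix-matrix exponentiations are $$A^B:=e^{\log(A)B},\qquad {}^{B}\!A:=e^{B\log(A)}.$$ $\sigma(M)$ denotes the spectrum of a matrix $M$; in (ii) the $n$ eigenvalues are listed with algebraic multiplicity. For scalars $\alpha\in\mathbb{C}\setminus\mathbb{R}_0^-$ and $\beta\in\mathbb{C}$, $\alpha^\beta:=e^{\beta\log\alpha}$ with $\log$ the principal logarithm. *)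

(* Defs.v *)
From HB Require Import structures.
From mathcomp Require Import all_boot all_order all_algebra all_fingroup.
From mathcomp Require Import all_classical all_reals all_analysis.
From mathcomp Require Import complex.

Set Implicit Arguments.
Unset Strict Implicit.
Unset Printing Implicit Defensive.

Import Order.TTheory GRing.Theory Num.Theory.
Import numFieldNormedType.Exports.

Local Open Scope classical_set_scope.
Local Open Scope ring_scope.
Local Open Scope complex_scope.

Section MatrixPower.
Variable R : realType.
Local Notation C := R[i].

(* The normed topology of a numFieldType K is attached to K^o; hence the limits
   below are taken in C^o and 'M[C^o]_n, which are convertible to C and
   'M[C]_n. *)
Definition cexp (z : C) : C :=
  limn (series (fun k => k`!%:R^-1 * z ^+ k : C^o)).

(* On nonzero z this is determined uniquely; the value at 0 is junk. *)
Definition clog (z : C) : C :=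
  xget 0 [set w | cexp w = z /\ - pi < complex.Im w <= pi].

Definition cpow (a b : C) : C := cexp (b * clog a).

Definition nonpos_reals : set C := [set x%:C | x in [set x : R | x <= 0]].

Section Matrices.
Variable n : nat.
Implicit Types A B X : 'M[C]_n.

Definition expm X : 'M[C]_n :=
  limn (series (fun k => k`!%:R^-1 *: X ^+ k : 'M[C^o]_n)).

Definition spectrum X : set C := [set z | eigenvalue X z].

(* [a] lists the eigenvalues of [X] with algebraic multiplicity. *)
Definition eigenvalues_are X (a : 'I_n -> C) : Prop :=
  char_poly X = \prod_i ('X - (a i)%:P).

Definition is_principal_log A X : Prop :=
  expm X = A /\ forall z, spectrum X z -> - pi < complex.Im z < pi.

(* The value is junk when [A] has an eigenvalue in [nonpos_reals]. *)
Definition logm A : 'M[C]_n := xget 0 (is_principal_log A).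

(* A^B *)
Definition mxpowr A B : 'M[C]_n := expm (logm A *m B).

(* {}^B A *)
Definition mxpowl A B : 'M[C]_n := expm (B *m logm A).

End Matrices.
End MatrixPower.

Arguments nonpos_reals : clear implicits.

(* Main.v *)
(* Write L = log A.  Termwise in the series, B (LB)^k = (BL)^k B, hence (iii); e^X has the
   eigenvalues e^w, w an eigenvalue of X, by triangularization; so (i) reduces to
   the equality of the spectra of LB and BL.
   For (ii), a principal logarithm of A is built inside the bicommutant of A: start
   from p(A), where the polynomial p interpolates the scalar logarithm at the
   eigenvalues of A, and run Newton's iteration; the initial defect is nilpotent and
   the defect is squared at each step, so that the iteration stops.  It is the only
   principal logarithm: two of them commute, so their difference D is nilpotent with
   e^D = 1, hence D = 0.  Thus log A commutes with B, and log A, B and A^B are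
   simultaneously triangularizable. *)
Require Import Defs.
From mathcomp Require Import all_boot all_order all_algebra all_fingroup.
From mathcomp Require Import all_classical all_reals all_analysis.
From mathcomp Require Import complex.

Import Order.TTheory GRing.Theory Num.Theory.
Import numFieldNormedType.Exports.

Local Open Scope classical_set_scope.
Local Open Scope ring_scope.
Local Open Scope complex_scope.

Set Implicit Arguments.
Unset Strict Implicit.
Unset Printing Implicit Defensive.

(** * Convergence of complex series by comparison with real ones *)

Section ComplexSeries.
Variable R : realType.
Local Notation C := R[i].

Lemma normC_real (x : R) : `|x%:C| = `|x|%:C.
Proof. by rewrite normc_def /= expr0n addr0 sqrtr_sqr. Qed.

(** A positive complex tolerance has zero imaginary part, so it is already a real tolerance. *)
Lemma cvg_real_complex (u : nat -> R) (l : R) :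
  u @ \oo --> l -> (fun k => (u k)%:C : C^o) @ \oo --> (l%:C : C^o).
Proof.
move=> ul; apply/cvgrPdist_lt => e e0.
have [Ime e0'] : complex.Im e = 0 /\ 0 < complex.Re e.
  by move: e0; rewrite ltcE /= => /andP[/eqP -> ->].
have eE : e = (complex.Re e)%:C by case: e Ime {e0 e0'} => a b /= ->.
have /cvgrPdist_lt /(_ _ e0') := ul; apply: filterS => k.
by rewrite eE -rmorphB normC_real ltcR.
Qed.

Lemma Re_Im_le_norm (z : C) :
  `|complex.Re z| <= complex.Re `|z| /\ `|complex.Im z| <= complex.Re `|z|.
Proof.
rewrite normc_def /= -!sqrtr_sqr; split; apply: ler_wsqrtr.
  by rewrite lerDl sqr_ge0.
by rewrite lerDr sqr_ge0.
Qed.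

(** The real and imaginary parts are bounded by the modulus, so the real comparison test makes each
    of them absolutely convergent; the two sums are then recombined. *)
Lemma cvg_series_dominated (u : nat -> C) (v : nat -> R) :
  (forall k, `|u k| <= (v k)%:C) -> cvgn (series v) ->
  cvgn (series (u : nat -> C^o)).
Proof.
move=> uv cv.
have uvR k : complex.Re `|u k| <= v k.
  by have := uv k; rewrite lecE => /andP[_ /=].
have part (f : C -> R) : (forall z, `|f z| <= complex.Re `|z|) ->
    cvgn (series (f \o u)).
  move=> fle; apply: normed_cvg; apply: series_le_cvg cv => k //=.
    exact: le_trans (normr_ge0 _) (le_trans (fle _) (uvR k)).
  exact: le_trans (fle _) (uvR k).
have /cvg_ex[/= a ca] := part _ (fun z => (Re_Im_le_norm z).1).
have /cvg_ex[/= b cb] := part _ (fun z => (Re_Im_le_norm z).2).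
apply/cvg_ex; exists (a%:C + 'i * b%:C : C^o).
have -> : series (u : nat -> C^o) =
    (fun k => (series (@complex.Re R \o u) k)%:C +
              'i * (series (@complex.Im R \o u) k)%:C) :> (nat -> C^o).
  apply/funext => k; rewrite /series /= !rmorph_sum mulr_sumr -big_split /=.
  by apply: eq_bigr => i _; rewrite -complexE.
apply: (@cvgD C C^o); first exact: cvg_real_complex.
by apply: (@cvgM C); [exact: cvg_cst | exact: cvg_real_complex].
Qed.

End ComplexSeries.

(** * Entrywise limits of matrices *)

Section MatrixLimits.
Variables (K : numFieldType) (n : nat).
Implicit Types (u v : nat -> 'M[K]_n) (l a b : 'M[K]_n).

Lemma nbhs_coord_mx (l : 'M[K^o]_n) i j (D : set K^o) :
  nbhs (l i j) D -> nbhs l [set M : 'M[K^o]_n | D (M i j)].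
Proof.
move=> lD.
(* A product neighbourhood whose condition is vacuous at every entry other than [(i, j)]. *)
exists (fun i' j' => [set x | (i' = i /\ j' = j) -> D x]) => [i' j'|M MP].
  have [[-> ->]|ne] := pselect (i' = i /\ j' = j); first by apply: filterS lD => x ? _.
  by apply: (filterS _ filterT) => x _ /= /ne.
exact: (MP i j).
Qed.

Lemma cvg_mxP u l :
  (u : nat -> 'M[K^o]_n) @ \oo --> (l : 'M[K^o]_n) <->
  forall i j, (fun k => u k i j : K^o) @ \oo --> (l i j : K^o).
Proof.
split=> [ul i j A lA|ul A [P lP sPA]]; first exact: (ul _ (nbhs_coord_mx lA)).
have: \forall k \near \oo, forall i j, P i j (u k i j).
  by apply: filter_forall => i; apply: filter_forall => j; exact: ul (lP i j).
by apply: filterS => k Pk; apply: sPA.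
Qed.

Lemma mx_hausdorff : hausdorff_space 'M[K^o]_n.
Proof.
move=> p q pq; apply/matrixP => i j; apply: (@norm_hausdorff K K^o) => A B pA qB.
have [M [AM BM]] := pq _ _ (nbhs_coord_mx pA) (nbhs_coord_mx qB).
by exists (M i j).
Qed.

Lemma cvg_scalar_unique (u : nat -> K) (a b : K) :
  (u : nat -> K^o) @ \oo --> (a : K^o) -> (u : nat -> K^o) @ \oo --> (b : K^o) ->
  a = b.
Proof. by move=> ua ub; exact: (cvg_unique (@norm_hausdorff K K^o) ua ub). Qed.

Lemma cvg_scalar_sum (I : Type) (s : seq I) (u : I -> nat -> K) (l : I -> K) :
  (forall i, (u i : nat -> K^o) @ \oo --> (l i : K^o)) ->
  (fun N => \sum_(i <- s) u i N : K^o) @ \oo --> (\sum_(i <- s) l i : K^o).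
Proof.
move=> ul; elim: s => [|i s IHs].
  rewrite (_ : (fun N => _) = cst 0) ?big_nil; first exact: cvg_cst.
  by apply/funext => N; rewrite big_nil.
rewrite big_cons (_ : (fun N => _) = (fun N => u i N + \sum_(j <- s) u j N)).
  exact: (@cvgD K K^o).
by apply/funext => N; rewrite big_cons.
Qed.

Lemma cvg_mulmx u v a b :
  (forall i j, (fun N => u N i j : K^o) @ \oo --> (a i j : K^o)) ->
  (forall i j, (fun N => v N i j : K^o) @ \oo --> (b i j : K^o)) ->
  forall i j, (fun N => (u N * v N) i j : K^o) @ \oo --> ((a * b) i j : K^o).
Proof.
move=> ua vb i j; rewrite mxE.
rewrite (_ : (fun N => _) = (fun N => \sum_k u N i k * v N k j)).
  by apply: cvg_scalar_sum => k; exact: (@cvgM K).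
by apply/funext => N; rewrite mxE.
Qed.

End MatrixLimits.

(** * Rearrangement of double sums and products in rings *)

Section CauchyProduct.

Lemma sum_square_triangle (V : zmodType) (f : nat -> nat -> V) N :
  \sum_(0 <= i < N) \sum_(0 <= j < N) f i j =
  \sum_(0 <= k < N) \sum_(0 <= i < k.+1) f i (k - i)%N +
  \sum_(0 <= i < N) \sum_(0 <= j < N | (N <= i + j)%N) f i j.
Proof.
have -> : \sum_(0 <= k < N) \sum_(0 <= i < k.+1) f i (k - i)%N =
          \sum_(0 <= i < N) \sum_(0 <= j < N | (i + j < N)%N) f i j.
  transitivity (\sum_(0 <= k < N) \sum_(0 <= i < N | (i < k.+1)%N) f i (k - i)%N).
    rewrite big_nat [RHS]big_nat; apply: eq_bigr => k /andP[_ kN].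
    by rewrite (big_nat_widen _ _ N).
  rewrite (exchange_big_dep_nat predT) //=.
  rewrite big_nat [RHS]big_nat; apply: eq_bigr => i /andP[_ iN].
  transitivity (\sum_(i <= k < N) f i (k - i)%N).
    by rewrite [RHS](big_nat_widenl _ 0%N).
  rewrite -{1}(add0n i) big_addn.
  rewrite (big_nat_widen _ _ N) ?leq_subr //.
  apply: eq_big => [j|j _]; last by rewrite addnK.
  by rewrite ltn_subRL.
rewrite -big_split /=; apply: eq_bigr => i _.
rewrite (bigID (fun j => i + j < N)%N) /=; congr (_ + _).
by apply: eq_bigl => j; rewrite -leqNgt.
Qed.

Lemma expr_mulC (A : pzRingType) (x y : A) k :
  x * (y * x) ^+ k = (x * y) ^+ k * x.
Proof.
elim: k => [|k IHk]; first by rewrite !expr0 mulr1 mul1r.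
by rewrite exprSr mulrA IHk exprSr !mulrA.
Qed.

(** Brings an intertwining relation to the two-sided shape required by [expm_transport]. *)
Lemma mulr1_mul1r (A : pzRingType) (x y z w : A) :
  x * y * 1 = 1 * z * w <-> x * y = z * w.
Proof. by rewrite mulr1 mul1r. Qed.

End CauchyProduct.

(** * Partial sums of the exponential series, with entrywise bounds *)

Section ExponentialSums.
Variables (K : numFieldType) (n : nat).
Implicit Types X Y M P Q : 'M[K]_n.

Definition expm_sum X N : 'M[K]_n := \sum_(0 <= k < N) k`!%:R^-1 *: X ^+ k.

Definition exp_sum (x : K) N : K := \sum_(0 <= k < N) k`!%:R^-1 * x ^+ k.

(** Takes its values in [K], so that [exp_sum] applies to it and serves as a scalar majorant of
    [expm_sum]. *)
Definition entry_norm X : K := \sum_i \sum_j `|X i j|.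

Lemma entry_norm_ge0 X : 0 <= entry_norm X.
Proof. by do 2!apply: sumr_ge0 => ? _. Qed.

(** A column of [X] has absolute sum at most [entry_norm X]. The left factor [M] is arbitrary, so
    that the bound iterates to powers and to products [X ^+ i * Y ^+ j]. *)
Lemma norm_mulmx_le M X (m : K) :
  (forall a b, `|M a b| <= m) ->
  forall a b, `|(M * X) a b| <= m * entry_norm X.
Proof.
move=> Mm a b; rewrite mxE mulr_sumr.
apply: le_trans (ler_norm_sum _ _ _) _; apply: ler_sum => c _.
rewrite normrM; apply: ler_pM => //.
by rewrite (bigD1 b) //= lerDl sumr_ge0.
Qed.

Lemma norm_mulmx_exp_le M X (m : K) k :
  (forall a b, `|M a b| <= m) ->
  forall a b, `|(M * X ^+ k) a b| <= m * entry_norm X ^+ k.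
Proof.
move=> Mm; elim: k => [|k IHk] a b; first by rewrite !expr0 !mulr1.
by rewrite !exprSr !mulrA; exact: norm_mulmx_le.
Qed.

Lemma norm_exp_le X k a b : `|(X ^+ k) a b| <= entry_norm X ^+ k.
Proof.
have := @norm_mulmx_exp_le 1 X 1 k; rewrite !mul1r; apply => i j.
by rewrite mxE normr_nat; case: eqP => _; rewrite ?ler01.
Qed.

Lemma expm_sumE X N i j :
  expm_sum X N i j = \sum_(0 <= k < N) k`!%:R^-1 * (X ^+ k) i j.
Proof. by rewrite summxE; apply: eq_bigr => k _; rewrite mxE. Qed.

Lemma expm_sum_transport P Q P' Q' X Y N :
  (forall k, P * X ^+ k * Q = P' * Y ^+ k * Q') ->
  P * expm_sum X N * Q = P' * expm_sum Y N * Q'.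
Proof.
move=> h; rewrite -!mulmxE !mulmx_sumr !mulmx_suml; apply: eq_bigr => k _.
by rewrite -!scalemxAr -!scalemxAl !mulmxE h.
Qed.

Lemma expm_sum_nilpotent X N m : X ^+ N = 0 -> (N <= m)%N ->
  expm_sum X m = expm_sum X N.
Proof.
move=> XN Nm; rewrite /expm_sum (big_cat_nat _ Nm) //=.
rewrite [X in _ + X]big_nat [X in _ + X]big1 ?addr0 // => k /andP[Nk _].
by rewrite -(subnK Nk) exprD XN mulr0 scaler0.
Qed.

Lemma expr_conjmx P X k : P \in unitmx ->
  (P * X * invmx P) ^+ k = P * X ^+ k * invmx P.
Proof.
move=> Pu; elim: k => [|k IHk]; first by rewrite !expr0 mulr1 -mulmxE mulmxV.
by rewrite !exprSr IHk -!mulmxE !mulmxA mulmxKV.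
Qed.

Lemma inv_fact_bin i k : (i <= k)%N ->
  k`!%:R^-1 * 'C(k, i)%:R = i`!%:R^-1 * (k - i)`!%:R^-1 :> K.
Proof.
move=> ik; rewrite -(bin_fact ik) !natrM !invfM.
by rewrite mulrAC mulVf ?mul1r // pnatr_eq0 -lt0n bin_gt0.
Qed.

(** By the binomial theorem the degree-[k] term of the exponential of the sum is the [k]-th
    antidiagonal of the product, so only the corner [N <= i + j] survives. The order [Y + X] makes
    [i] the exponent of [X] in the binomial expansion. *)
Lemma expm_sum_productE X Y N : X * Y = Y * X ->
  expm_sum X N * expm_sum Y N - expm_sum (Y + X) N =
  \sum_(0 <= i < N) \sum_(0 <= j < N | (N <= i + j)%N)
    (i`!%:R^-1 * j`!%:R^-1) *: (X ^+ i * Y ^+ j).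
Proof.
move=> XY; pose f i j : 'M[K]_n := (i`!%:R^-1 * j`!%:R^-1) *: (X ^+ i * Y ^+ j).
have -> : expm_sum X N * expm_sum Y N =
    \sum_(0 <= i < N) \sum_(0 <= j < N) f i j.
  rewrite /expm_sum big_distrlr /=; apply: eq_bigr => i _; apply: eq_bigr => j _.
  by rewrite -!mulmxE -scalemxAl -scalemxAr scalerA.
have -> : expm_sum (Y + X) N =
    \sum_(0 <= k < N) \sum_(0 <= i < k.+1) f i (k - i)%N.
  apply: eq_bigr => k _; rewrite exprDn_comm // big_mkord scaler_sumr.
  apply: eq_bigr => i _.
  rewrite -scalerMnr scalerMnl -mulr_natr inv_fact_bin -1?ltnS // /f.
  by congr (_ *: _); apply: commrX; apply/commr_sym/commrX.
by rewrite sum_square_triangle addrC addKr.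
Qed.

Lemma exp_sum_productE x y N :
  exp_sum x N * exp_sum y N - exp_sum (y + x) N =
  \sum_(0 <= i < N) \sum_(0 <= j < N | (N <= i + j)%N)
    (i`!%:R^-1 * j`!%:R^-1) * (x ^+ i * y ^+ j).
Proof.
pose f i j : K := (i`!%:R^-1 * j`!%:R^-1) * (x ^+ i * y ^+ j).
have -> : exp_sum x N * exp_sum y N = \sum_(0 <= i < N) \sum_(0 <= j < N) f i j.
  rewrite big_distrlr /=; apply: eq_bigr => i _; apply: eq_bigr => j _.
  by rewrite mulrACA.
have -> : exp_sum (y + x) N =
    \sum_(0 <= k < N) \sum_(0 <= i < k.+1) f i (k - i)%N.
  apply: eq_bigr => k _; rewrite exprDn big_mkord mulr_sumr.
  apply: eq_bigr => i _.
  rewrite mulrnAr -mulrnAl -[_ *+ 'C(_, _)]mulr_natr inv_fact_bin -1?ltnS //.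
  by rewrite (mulrC (y ^+ _)).
by rewrite sum_square_triangle addrC addKr.
Qed.

(** The corner has nonnegative coefficients, so it is bounded term by term by the same corner for
    the numbers [entry_norm X] and [entry_norm Y]. *)
Lemma norm_expm_sum_product X Y N : X * Y = Y * X ->
  forall a b, `|(expm_sum X N * expm_sum Y N - expm_sum (Y + X) N) a b| <=
    exp_sum (entry_norm X) N * exp_sum (entry_norm Y) N -
    exp_sum (entry_norm Y + entry_norm X) N.
Proof.
move=> XY a b; rewrite expm_sum_productE // exp_sum_productE summxE.
apply: le_trans (ler_norm_sum _ _ _) _; apply: ler_sum => i _; rewrite summxE.
apply: le_trans (ler_norm_sum _ _ _) _; apply: ler_sum => j _.
rewrite mxE normrM ger0_norm ?mulr_ge0 ?invr_ge0 //.
rewrite ler_wpM2l ?mulr_ge0 ?invr_ge0 //.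
by apply: norm_mulmx_exp_le => *; apply: norm_exp_le.
Qed.

End ExponentialSums.

(** * The matrix exponential: convergence, intertwining, addition formula *)

Section MatrixExponential.
Variables (R : realType) (n : nat).
Local Notation C := R[i].
Implicit Types X Y M P Q : 'M[C]_n.

Lemma exp_sum_real (x : R) N : exp_sum x%:C N = (series (exp_coeff x) N)%:C.
Proof.
rewrite rmorph_sum; apply: eq_bigr => k _.
by rewrite /exp_coeff /= rmorphM /= rmorphXn fmorphV rmorph_nat mulrC.
Qed.

Lemma entry_norm_real X : exists x : R, entry_norm X = x%:C.
Proof.
exists (complex.Re (entry_norm X)).
by rewrite RRe_real // ger0_real // entry_norm_ge0.
Qed.

Lemma cvg_expm X i j :
  (fun N => expm_sum X N i j : C^o) @ \oo --> (expm X i j : C^o).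
Proof.
have [x xE] := entry_norm_real X.
have cv a b : cvgn (fun N => expm_sum X N a b : C^o).
  rewrite (_ : (fun N => _) =
    series (fun k => k`!%:R^-1 * (X ^+ k) a b : C^o)); last first.
    by apply/funext => N; exact: expm_sumE.
  apply: (@cvg_series_dominated _ _ (exp_coeff x)); last first.
    exact: is_cvg_series_exp_coeff.
  move=> k; rewrite normrM mulrC /exp_coeff /= rmorphM rmorphXn /= -xE.
  rewrite fmorphV rmorph_nat normfV normr_nat.
  by rewrite ler_wpM2r ?norm_exp_le // invr_ge0 ler0n.
(* The entrywise limits form a matrix limit, which separation of the matrix topology identifies with
   [expm X]. *)
pose L : 'M[C]_n := \matrix_(a, b) limn (fun N => expm_sum X N a b : C^o).
have XL : (expm_sum X : nat -> 'M[C^o]_n) @ \oo --> (L : 'M[C^o]_n).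
  by apply/cvg_mxP => a b; rewrite mxE; exact: cv.
have -> : expm X = L by apply: cvg_lim XL; exact: mx_hausdorff.
exact: (cvg_mxP _ _).1 XL i j.
Qed.

(** Common source of the conjugation and commutation rules and of (iii): a relation valid for all
    powers passes to partial sums by linearity, then to the limit. *)
Lemma expm_transport P Q P' Q' X Y :
  (forall k, P * X ^+ k * Q = P' * Y ^+ k * Q') ->
  P * expm X * Q = P' * expm Y * Q'.
Proof.
move=> h; apply/matrixP => i j.
have cv (P0 X0 Q0 : 'M[C]_n) :
    (fun N => (P0 * expm_sum X0 N * Q0) i j : C^o) @ \oo -->
    ((P0 * expm X0 * Q0) i j : C^o).
  apply: cvg_mulmx => [a b|? ?]; last exact: cvg_cst.
  by apply: cvg_mulmx => [? ?|? ?]; [exact: cvg_cst | exact: cvg_expm].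
apply: cvg_scalar_unique (cv P X Q) _.
rewrite (_ : (fun N => _) = (fun N => (P' * expm_sum Y N * Q') i j)) //.
by apply/funext => N; congr (fun_of_matrix _ i j); exact: expm_sum_transport.
Qed.

Lemma expm_conj P X : P \in unitmx -> expm (P * X * invmx P) = P * expm X * invmx P.
Proof.
move=> Pu; rewrite -[LHS]mul1r -[LHS]mulr1; apply: expm_transport => k.
by rewrite mul1r mulr1; exact: expr_conjmx.
Qed.

Lemma comm_expm X Y : X * Y = Y * X -> X * expm Y = expm Y * X.
Proof.
move=> XY; apply/mulr1_mul1r; apply: expm_transport => k.
by apply/mulr1_mul1r; apply: commrX.
Qed.

Lemma expm_mulC X Y : X * expm (Y * X) = expm (X * Y) * X.
Proof.
apply/mulr1_mul1r; apply: expm_transport => k.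
by apply/mulr1_mul1r; exact: expr_mulC.
Qed.

Lemma expm_nilpotent X N : X ^+ N = 0 -> expm X = expm_sum X N.
Proof.
move=> XN; apply/matrixP => i j; apply: cvg_scalar_unique (@cvg_expm X i j) _.
apply: cvg_near_cst; exists N => // m /= Nm.
by rewrite (expm_sum_nilpotent XN Nm).
Qed.

Lemma expm0 : expm (0 : 'M[C]_n) = 1.
Proof.
by rewrite (@expm_nilpotent _ 1) ?expr1 // /expm_sum big_nat1 expr0 fact0 invr1 scale1r.
Qed.

(* The error between the partial sums of the two sides is dominated entrywise by
   the same error for the numbers [entry_norm X] and [entry_norm Y], which tends to
   0 by the addition formula of the real exponential. *)
Lemma expmD X Y : X * Y = Y * X -> expm (X + Y) = expm X * expm Y.
Proof.
move=> XY; apply/matrixP => a b.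
have subE (U V : 'M[C]_n) : (U - V) a b = U a b - V a b by rewrite !mxE.
have cvL : (fun N => (expm_sum X N * expm_sum Y N - expm_sum (Y + X) N) a b : C^o)
    @ \oo --> ((expm X * expm Y - expm (Y + X)) a b : C^o).
  rewrite subE (_ : (fun N => _) = (fun N => (expm_sum X N * expm_sum Y N) a b -
      expm_sum (Y + X) N a b)); last by apply/funext => N; exact: subE.
  apply: (@cvgB C C^o); last exact: cvg_expm.
  by apply: cvg_mulmx => ? ?; apply: cvg_expm.
have [[x xE] [y yE]] := (entry_norm_real X, entry_norm_real Y).
pose d N := series (exp_coeff x) N * series (exp_coeff y) N -
            series (exp_coeff (y + x)) N.
have d0 : d @ \oo --> (0 : R).
  have -> : 0 = expR x * expR y - expR (y + x) by rewrite expRD mulrC subrr.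
  by apply: cvgB; [apply: cvgM|]; exact: is_cvg_series_exp_coeff.
have cv0 : (fun N => (expm_sum X N * expm_sum Y N - expm_sum (Y + X) N) a b : C^o)
    @ \oo --> (0 : C^o).
  apply/cvgrPdist_lt => e e0; have /cvgrPdist_lt /(_ _ e0) := cvg_real_complex d0.
  apply: filterS => N; rewrite !sub0r !normrN; apply: le_lt_trans.
  apply: le_trans (norm_expm_sum_product N XY a b) _.
  rewrite xE yE -rmorphD !exp_sum_real -rmorphM -rmorphB /= normC_real lecR.
  exact: ler_norm.
have := cvg_scalar_unique cvL cv0; rewrite subE => /eqP.
by rewrite subr_eq0 addrC => /eqP ->.
Qed.

Lemma expmN_mul X : expm (- X) * expm X = 1.
Proof. by rewrite -expmD ?addNr ?expm0 // mulNr mulrN. Qed.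

End MatrixExponential.

(** * Triangularization with a recorded diagonal *)

Section TriangularMatrices.
Variables (K : fieldType) (n : nat).
Implicit Types (P X Y T S : 'M[K]_n) (d e : 'I_n -> K).

Lemma is_trig_mulmx T S : is_trig_mx T -> is_trig_mx S ->
  is_trig_mx (T * S) /\ forall i, (T * S) i i = T i i * S i i.
Proof.
move=> /is_trig_mxP Tt /is_trig_mxP St; split=> [|i].
  apply/is_trig_mxP => i j ij; rewrite mxE big1 // => k _.
  have [ik|ki] := ltnP i k; first by rewrite Tt ?mul0r.
  by rewrite St ?mulr0 //; apply: leq_ltn_trans ij.
rewrite mxE (bigD1 i) //= big1 ?addr0 // => k ki.
have [ik|{}ki'] := ltnP i k; first by rewrite Tt ?mul0r.
by rewrite St ?mulr0 // ltn_neqAle ki' andbT.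
Qed.

Lemma char_poly_conj P X : P \in unitmx -> char_poly (P * X * invmx P) = char_poly X.
Proof.
move=> Pu; rewrite /char_poly.
have -> : char_poly_mx (P * X * invmx P) =
    map_mx polyC P *m char_poly_mx X *m map_mx polyC (invmx P).
  rewrite /char_poly_mx mulmxBr mulmxBl -!mulmxE !map_mxM; congr (_ - _).
  by rewrite scalar_mxC -mulmxA -map_mxM mulmxV // map_mx1 mulmx1.
rewrite !det_mulmx mulrC mulrA -det_mulmx -map_mxM mulVmx // map_mx1 det1.
by rewrite mul1r.
Qed.

(** Keeping the diagonal as an indexed family lets matrices triangularized by the same [P] have
    their eigenvalues paired index by index; this pairing is what (ii) rests on. *)
Definition trig_by P X d :=
  [/\ P \in unitmx, is_trig_mx (P * X * invmx P)
    & forall i, (P * X * invmx P) i i = d i].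

Lemma similar_trig_by P X : P \in unitmx -> similar_trig P X ->
  trig_by P X (fun i => (P * X * invmx P) i i).
Proof. by move=> Pu; rewrite /similar_to /= conjumx. Qed.

Lemma trig_byM P X Y d e : trig_by P X d -> trig_by P Y e ->
  trig_by P (X * Y) (fun i => d i * e i).
Proof.
move=> [Pu Xt Xd] [_ Yt Ye]; have [t h] := is_trig_mulmx Xt Yt.
have E : P * (X * Y) * invmx P = P * X * invmx P * (P * Y * invmx P).
  by rewrite -!mulmxE !mulmxA mulmxKV.
by split=> //; rewrite E // => i; rewrite h Xd Ye.
Qed.

Lemma trig_byD P X Y d e : trig_by P X d -> trig_by P Y e ->
  trig_by P (X + Y) (fun i => d i + e i).
Proof.
move=> [Pu /is_trig_mxP Xt Xd] [_ /is_trig_mxP Yt Ye].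
rewrite /trig_by mulrDr mulrDl; split=> // [|i]; last by rewrite mxE Xd Ye.
by apply/is_trig_mxP => i j ij; rewrite mxE Xt // Yt // addr0.
Qed.

Lemma trig_byZ P X d (a : K) : trig_by P X d ->
  trig_by P (a *: X) (fun i => a * d i).
Proof.
move=> [Pu /is_trig_mxP Xt Xd].
rewrite /trig_by -!mulmxE -scalemxAr -scalemxAl; split=> // [|i]; last by rewrite mxE Xd.
by apply/is_trig_mxP => i j ij; rewrite mxE Xt // mulr0.
Qed.

Lemma trig_byN P X d : trig_by P X d -> trig_by P (- X) (fun i => - d i).
Proof.
move=> /(trig_byZ (-1)); rewrite scaleN1r => -[Pu Xt Xd].
by split=> // i; rewrite Xd mulN1r.
Qed.

Lemma trig_by1 P : P \in unitmx -> trig_by P 1 (fun=> 1).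
Proof.
move=> Pu; rewrite /trig_by mulr1 -mulmxE mulmxV //.
by split; rewrite ?scalar_mx_is_trig // => i; rewrite mxE eqxx.
Qed.

Lemma trig_byX P X d k : trig_by P X d -> trig_by P (X ^+ k) (fun i => d i ^+ k).
Proof.
move=> Xd; elim: k => [|k IHk].
  by rewrite expr0; apply: trig_by1; case: Xd.
by rewrite exprS; have := trig_byM Xd IHk; under eq_fun do rewrite -exprS.
Qed.

Lemma trig_by_horner P X d (p : {poly K}) : trig_by P X d ->
  trig_by P (\sum_(k < size p) p`_k *: X ^+ k) (fun i => p.[d i]).
Proof.
move=> Xd; have Pu : P \in unitmx by case: Xd.
under [X in trig_by _ _ X]eq_fun do rewrite horner_coef.
elim: (size p) => [|N IHN].
  rewrite big_ord0; under eq_fun do rewrite big_ord0.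
  have := trig_byZ 0 (trig_by1 Pu); rewrite scale0r.
  by under eq_fun do rewrite mul0r.
rewrite big_ord_recr; under [X in trig_by _ _ X]eq_fun do rewrite big_ord_recr.
exact: trig_byD IHN (trig_byZ _ (trig_byX _ Xd)).
Qed.

Lemma trig_by_char_poly P X d : trig_by P X d ->
  char_poly X = \prod_i ('X - (d i)%:P).
Proof.
move=> [Pu Xt Xd]; rewrite -(char_poly_conj X Pu) char_poly_trig //.
by apply: eq_bigr => i _; rewrite Xd.
Qed.

(** The characteristic polynomial is ['X ^+ n], and Cayley-Hamilton applies; in dimension 0 all
    matrices are equal. *)
Lemma trig_by_nilpotent P X : trig_by P X (fun=> 0) -> X ^+ n = 0.
Proof.
move=> /trig_by_char_poly; rewrite prodr_const card_ord subr0.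
case: n X => [|m] X cX; first by apply/matrixP => -[].
by have := Cayley_Hamilton X; rewrite cX rmorphXn /= horner_mx_X.
Qed.

Lemma trig_by_eigenvalue P X d z : trig_by P X d ->
  eigenvalue X z <-> exists i, z = d i.
Proof.
move=> /trig_by_char_poly cX; rewrite eigenvalue_root_char cX.
rewrite -(big_map d predT (fun a => 'X - a%:P)) root_prod_XsubC.
split=> [/mapP[i _ ->]|[i ->]]; first by exists i.
by apply: map_f; rewrite mem_index_enum.
Qed.

(** The multiplicity of a root counts its occurrences in the family, so both families are the same
    multiset. The permutations of (ii) come from here. *)
Lemma perm_of_prod_XsubC d e :
  \prod_i ('X - (d i)%:P) = \prod_i ('X - (e i)%:P) ->
  exists s : 'S_n, forall i, d i = e (s i).
Proof.
move=> de.
have /tuple_permP[s sE] : perm_eq [tuple d i | i < n] [tuple e i | i < n].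
  have countE (f : 'I_n -> K) x : count_mem x [tuple f i | i < n] =
      mup x (\prod_i ('X - (f i)%:P)).
    by rewrite -mu_prod_XsubC big_map big_enum.
  by apply/allP => x _ /=; rewrite !countE de.
exists s => i; move/val_inj/(congr1 (fun t => tnth t i)): sE.
by rewrite !tnth_mktuple.
Qed.

End TriangularMatrices.

(** * The scalar exponential and its inverse on the principal strip *)

Section ScalarExponential.
Variable R : realType.
Local Notation C := R[i].
Implicit Types (z w : C) (x y : R).

Lemma cvg_cexp z : (exp_sum z : nat -> C^o) @ \oo --> (cexp z : C^o).
Proof.
suff cv : cvgn (series (fun k => k`!%:R^-1 * z ^+ k : C^o)) by exact: cv.
pose r : R := complex.Re `|z|.
apply: (@cvg_series_dominated _ _ (exp_coeff r)); last first.
  exact: is_cvg_series_exp_coeff.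
move=> k; rewrite normrM normfV normr_nat normrX mulrC /exp_coeff /= rmorphM rmorphXn /=.
by rewrite fmorphV rmorph_nat.
Qed.

Lemma expm_sum_scalar (K : numFieldType) (z : K) N :
  expm_sum (z%:M : 'M[K]_1) N 0 0 = exp_sum z N.
Proof.
rewrite expm_sumE; apply: eq_bigr => k _.
by rewrite -rmorphXn /= mxE eqxx.
Qed.

(** Through matrices of size 1 the addition formula for [expm] yields the one for [cexp]. *)
Lemma cexp_mx z : cexp z = expm (z%:M : 'M[C]_1) 0 0.
Proof.
apply: cvg_scalar_unique (@cvg_cexp z) _.
rewrite (_ : exp_sum z = (fun N => expm_sum (z%:M : 'M[C]_1) N 0 0)).
  exact: cvg_expm.
by apply/funext => N; rewrite expm_sum_scalar.
Qed.

Lemma cexpD z w : cexp (z + w) = cexp z * cexp w.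
Proof.
rewrite !cexp_mx raddfD expmD; last by rewrite -!mulmxE scalar_mxC.
by rewrite mxE big_ord1.
Qed.

Lemma cexp0 : cexp (0 : C) = 1.
Proof. by rewrite cexp_mx raddf0 expm0 mxE. Qed.

Lemma cexpN_mul z : cexp (- z) * cexp z = 1.
Proof. by rewrite -cexpD addNr cexp0. Qed.

Lemma cexp_real x : cexp x%:C = (expR x)%:C.
Proof.
apply: cvg_scalar_unique (@cvg_cexp _) _.
rewrite (_ : exp_sum x%:C = (fun N => (series (exp_coeff x) N)%:C)).
  by apply: cvg_real_complex; exact: is_cvg_series_exp_coeff.
by apply/funext => N; exact: exp_sum_real.
Qed.

Lemma exp_term_imag y k :
  k`!%:R^-1 * ('i * y%:C) ^+ k = (cos_coeff y k)%:C + 'i * (sin_coeff y k)%:C :> C.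
Proof.
rewrite exprMn -rmorphXn /cos_coeff /sin_coeff /=.
have kE : k`!%:R^-1 = (k`!%:R^-1)%:C :> C by rewrite fmorphV rmorph_nat.
have i2 m : 'i ^+ m.*2 = ((-1) ^+ m)%:C :> C.
  by rewrite -muln2 mulnC exprM sqr_i rmorphXn rmorphN1.
have ik : 'i ^+ k = 'i ^+ odd k * ((-1) ^+ k./2)%:C :> C.
  by rewrite -{1}(odd_double_half k) exprD i2.
rewrite ik kE -exprnP mulrC; case: (boolP (odd k)) => ok /=.
  rewrite !mul0r rmorph0 add0r mul1r expr1.
  (* [sin_coeff] carries the exponent [k.-1./2], which for odd [k] is the [k./2] coming from the
     power of ['i]. *)
  have -> : k.-1./2 = k./2.
    by case: k ok {kE ik} => //= k; rewrite uphalf_half => /negbTE ->.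
  by rewrite !rmorphM /= !mulrA.
by rewrite !mul0r rmorph0 mulr0 addr0 !mul1r !rmorphM.
Qed.

Lemma cexp_imag y : cexp ('i * y%:C) = (cos y)%:C + 'i * (sin y)%:C.
Proof.
apply: cvg_scalar_unique (@cvg_cexp _) _.
rewrite (_ : exp_sum _ = (fun N => (series (cos_coeff y) N)%:C +
                                   'i * (series (sin_coeff y) N)%:C)).
  apply: (@cvgD C C^o).
    by apply: cvg_real_complex; rewrite cos.unlock; exact: is_cvg_series_cos_coeff.
  apply: (@cvgM C); first exact: cvg_cst.
  by apply: cvg_real_complex; rewrite sin.unlock; exact: is_cvg_series_sin_coeff.
apply/funext => N; rewrite /series /= !rmorph_sum mulr_sumr -big_split /=.
by apply: eq_bigr => k _; rewrite exp_term_imag.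
Qed.

Lemma cexpE x y : cexp (x +i* y) = (expR x * cos y) +i* (expR x * sin y).
Proof.
rewrite [x +i* y]complexE cexpD cexp_real cexp_imag.
by rewrite /=; simpc.
Qed.

(** [acos c] has the right cosine and a nonnegative sine; for negative [s] its opposite is taken. *)
Lemma angle_exists (c s : R) : c ^+ 2 + s ^+ 2 = 1 ->
  exists2 t : R, - pi < t <= pi & cos t = c /\ sin t = s.
Proof.
move=> cs1.
have c1 : -1 <= c <= 1.
  by rewrite -ler_norml -(@expr_le1 _ 2) // real_normK ?num_real // -cs1 lerDl sqr_ge0.
have sE : Num.sqrt (1 - c ^+ 2) = `|s| by rewrite -cs1 addrC addKr sqrtr_sqr.
have cI : c \in `[-1, 1] by rewrite in_itv.
have [s0|s0] := lerP 0 s.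
  exists (acos c); last by rewrite acosK // sin_acos // sE ger0_norm.
  by rewrite acos_lepi // andbT (lt_le_trans _ (acos_ge0 c1)) // oppr_lt0 pi_gt0.
exists (- acos c); last first.
  by rewrite cosN sinN acosK // sin_acos // sE ltr0_norm // opprK.
(* The value [c = -1] would force [s = 0]; excluding it gives [acos c < pi], hence the strict bound
   at [- pi]. *)
have : c != -1.
  apply: contraTneq s0 => c_N1; move: cs1; rewrite c_N1 sqrrN expr1n.
  by move/eqP; rewrite -subr_eq0 addrC addKr sqrf_eq0 => /eqP ->; rewrite ltxx.
move: c1 => /andP[cl cr] cN1; rewrite ltrN2 acos_ltpi /=; last first.
  by rewrite lt_neqAle eq_sym cN1 cl.
by rewrite (le_trans _ (pi_ge0 R)) // oppr_le0 acos_ge0 // cl.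
Qed.

Lemma clog_exists z : z != 0 -> exists w, cexp w = z /\ - pi < complex.Im w <= pi.
Proof.
case: z => a b z0; pose r := Num.sqrt (a ^+ 2 + b ^+ 2).
have r2 : r ^+ 2 = a ^+ 2 + b ^+ 2 by rewrite sqr_sqrtr // addr_ge0 ?sqr_ge0.
have r0 : 0 < r.
  rewrite sqrtr_gt0 lt_neqAle addr_ge0 ?sqr_ge0 // andbT eq_sym.
  by rewrite paddr_eq0 ?sqr_ge0 // !sqrf_eq0; move: z0; rewrite eq_complex.
have [|t tpi [ct st]] := @angle_exists (a / r) (b / r).
  by rewrite !expr_div_n -mulrDl -r2 divff // expf_neq0 // gt_eqF.
exists (ln r +i* t); split=> //; rewrite cexpE lnK ?posrE // ct st.
by rewrite ![r * _]mulrC !divfK ?gt_eqF.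
Qed.

(** Comparing moduli gives equal real parts. The imaginary parts then satisfy [cos (t - u) = 1], so
    the sine of half their difference vanishes, while that half lies strictly between [- pi] and
    [pi]. *)
Lemma cexp_inj_strip z w : - pi < complex.Im z <= pi -> - pi < complex.Im w <= pi ->
  cexp z = cexp w -> z = w.
Proof.
case: z w => [a t] [b u] /= /andP[tl tr] /andP[ul ur].
rewrite !cexpE => -[cE sE].
have abE : expR a = expR b.
  have pyth x y : (expR x * cos y) ^+ 2 + (expR x * sin y) ^+ 2 = expR x ^+ 2.
    by rewrite !exprMn -mulrDr cos2Dsin2 mulr1.
  have := pyth a t; rewrite cE sE pyth => /eqP.
  by rewrite eqrXn2 ?expR_ge0 // => /eqP.
have ne0 : expR b != 0 by rewrite gt_eqF ?expR_gt0.
move: cE sE; rewrite abE => /(mulfI ne0) cE /(mulfI ne0) sE.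
rewrite (expR_inj abE); congr (_ +i* _).
have sin0 : sin ((t - u) / 2) = 0.
  have : cos (t - u) = 1 by rewrite cosB cE sE -!expr2 cos2Dsin2.
  rewrite {1}[t - u]splitr cosD -!expr2 cos2sin2 -addrA -opprD -mulr2n => /eqP.
  by rewrite -subr_eq0 addrAC subrr add0r oppr_eq0 mulrn_eq0 sqrf_eq0 => /eqP.
have [tu|ut|//] := ltgtP t u.
  have : 0 < sin ((u - t) / 2).
    apply: sin_gt0_pi; rewrite divr_gt0 ?subr_gt0 //= ltr_pdivrMr // mulr_natr mulr2n.
    by rewrite ler_ltD // ltrNl.
  by rewrite -opprB mulNr sinN sin0 oppr0 ltxx.
have : 0 < sin ((t - u) / 2).
  apply: sin_gt0_pi; rewrite divr_gt0 ?subr_gt0 //= ltr_pdivrMr // mulr_natr mulr2n.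
  by rewrite ler_ltD // ltrNl.
by rewrite sin0 ltxx.
Qed.
End ScalarExponential.

(** * Triangular and second-order forms of the partial sums *)

Section ExponentialSumExpansion.
Variables (K : numFieldType) (n : nat).
Implicit Types X M S Q T : 'M[K]_n.

Lemma is_trig_expmx T k : is_trig_mx T ->
  is_trig_mx (T ^+ k) /\ forall i, (T ^+ k) i i = T i i ^+ k.
Proof.
move=> Tt; elim: k => [|k [IHt IHd]].
  by rewrite expr0 scalar_mx_is_trig; split=> // i; rewrite mxE eqxx.
have [t h] := is_trig_mulmx Tt IHt; rewrite exprS; split=> // i.
by rewrite h IHd exprS.
Qed.

Lemma expm_sum_trig T N (i j : 'I_n) : is_trig_mx T -> (i <= j)%N ->
  expm_sum T N i j = if i == j then exp_sum (T i i) N else 0.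
Proof.
move=> Tt ij; rewrite expm_sumE; case: eqP => [<-|/eqP ne].
  by apply: eq_bigr => k _; rewrite (is_trig_expmx k Tt).2.
rewrite big1 // => k _; have /is_trig_mxP -> := (is_trig_expmx k Tt).1.
  by rewrite mulr0.
by rewrite ltn_neqAle ij andbT.
Qed.

Lemma expm_sum_expansion X m : exists S,
  S * X = X * S /\ expm_sum X m.+2 = 1 + X + X ^+ 2 * S.
Proof.
exists (\sum_(k < m) k.+2`!%:R^-1 *: X ^+ k); split.
  rewrite -!mulmxE mulmx_suml mulmx_sumr; apply: eq_bigr => k _.
  by rewrite -scalemxAl -scalemxAr !mulmxE -exprSr exprS.
rewrite /expm_sum big_mkord !big_ord_recl /= expr0 fact0 invr1 !scale1r.
rewrite expr1 addrA; congr (_ + _).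
rewrite -mulmxE mulmx_sumr; apply: eq_bigr => k _.
by rewrite -scalemxAr mulmxE -exprD.
Qed.

(* The identity behind the quadratic convergence in [newton_log]. *)
Lemma expm_sum_newton M m : exists Q,
  Q * M = M * Q /\ (1 + M) * expm_sum (- M) m.+2 - 1 = M ^+ 2 * Q.
Proof.
have [S [SM ->]] := expm_sum_expansion (- M) m.
have {}SM : S * M = M * S.
  by apply: oppr_inj; rewrite -mulrN SM mulNr.
(* Read off from [(1 + M) * (1 - M + M ^+ 2 * S) - 1], where [(1 + M) * (1 - M) = 1 - M ^+ 2]. *)
exists (- 1 + (1 + M) * S); split.
  rewrite mulrDr mulrDl mulN1r mulrN1 -mulrA SM; congr (_ + _).
  by rewrite !mulrA mulrDl mulrDr mul1r mulr1.
have E1 : (1 + M) * (1 - M) = 1 - M ^+ 2.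
  by rewrite mulrBr mulr1 mulrDl mul1r opprD addrA addrK expr2.
have E2 : (1 + M) * M ^+ 2 = M ^+ 2 * (1 + M).
  by rewrite mulrDl mulrDr mul1r mulr1 -exprS -exprSr.
rewrite sqrrN mulrDr E1 mulrA E2 [RHS]mulrDr mulrN1 -mulrA.
by rewrite addrAC [1 - _]addrC addrK.
Qed.

(** The expansion gives [X = X ^+ 2 * (- S)]; substituting repeatedly puts arbitrarily high powers
    of [X] in front. *)
Lemma expm_sum_nilpotent_eq1 X m : X ^+ m = 0 -> expm_sum X m.+2 = 1 -> X = 0.
Proof.
have [S [SX ->]] := expm_sum_expansion X m.
move=> Xm; rewrite -[RHS]addr0 -addrA => /addrI /eqP.
rewrite addr_eq0 -mulrN => /eqP XE.
have it k : X = X ^+ k.+1 * (- S) ^+ k.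
  elim: k => [|k IHk]; first by rewrite expr0 expr1 mulr1.
  have XkE : X ^+ k * X = X ^+ k.+2 * - S by rewrite {2}XE mulrA -exprD addn2.
  by rewrite {1}IHk exprSr XkE -mulrA -exprS.
by rewrite (it m) exprS Xm mulr0 mul0r.
Qed.

End ExponentialSumExpansion.

(** * Simultaneous triangularization and spectra of products *)

Lemma cotrigonalization_by (K : numClosedFieldType) m (X Y : 'M[K]_m) :
  X * Y = Y * X ->
  exists (P : 'M[K]_m) (d e : 'I_m -> K), trig_by P X d /\ trig_by P Y e.
Proof.
move=> /cotrigonalization2[P Pu /andP[XP YP]].
have {}Pu := unitarymx_unit Pu.
exists P, (fun i => (P * X * invmx P) i i), (fun i => (P * Y * invmx P) i i).
by split; exact: similar_trig_by.
Qed.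

(** For a nonzero eigenvalue with row eigenvector [v], the vector [v *m X] works: if it vanished, so
    would [a *: v]. The eigenvalue 0 is detected by the determinant, which is insensitive to the
    order of the factors. *)
Lemma eigenvalue_mulmxC (K : fieldType) n (X Y : 'M[K]_n) a :
  eigenvalue (X * Y) a -> eigenvalue (Y * X) a.
Proof.
rewrite -!mulmxE => /eigenvalueP[v vXY v0].
have [a0|a0] := eqVneq a 0.
  have YX0 : \det (Y *m X) == 0.
    rewrite det_mulmx mulrC -det_mulmx; apply/det0P.
    by exists v; rewrite // vXY a0 scale0r.
  by case/det0P: YX0 => w w0 wYX; apply/eigenvalueP; exists w; rewrite // wYX a0 scale0r.
apply/eigenvalueP; exists (v *m X).
  by rewrite mulmxA -[v *m X *m Y]mulmxA vXY scalemxAl.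
apply: contraNneq v0 => vX0; move: vXY; rewrite mulmxA vX0 mul0mx => /esym/eqP.
by rewrite scaler_eq0 (negPf a0).
Qed.

(** * Existence and uniqueness of the principal logarithm *)

Section PrincipalLogarithm.
Variables (R : realType) (n : nat).
Local Notation C := R[i].
Implicit Types (A B X Y Z M P : 'M[C]_n) (d e : 'I_n -> C).

Lemma clogK (z : C) : z != 0 ->
  cexp (clog z) = z /\ - pi < complex.Im (clog z) <= pi.
Proof. by move=> z0; exact: (xgetPex 0 (clog_exists z0)). Qed.

Lemma cexp_neq0 (z : C) : cexp z != 0.
Proof.
apply: contra_eq_neq (cexpN_mul z) => ->.
by rewrite mulr0 eq_sym oner_eq0.
Qed.

Lemma cexpK (w : C) : - pi < complex.Im w <= pi -> clog (cexp w) = w.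
Proof.
move=> wpi; have [lE lpi] := clogK (cexp_neq0 w).
exact: cexp_inj_strip.
Qed.

(** Imaginary part exactly [pi] would make [z] the negative real [- expR (complex.Re (clog z))]. *)
Lemma clog_lt_pi (z : C) : ~ nonpos_reals R z ->
  cexp (clog z) = z /\ - pi < complex.Im (clog z) < pi.
Proof.
move=> zN; have z0 : z != 0.
  by apply/eqP => z0; apply: zN; exists 0 => //=; rewrite z0.
have [lE /andP[lpi lpi']] := clogK z0; split=> //; rewrite lpi lt_neqAle lpi' andbT.
apply/eqP => Epi; apply: zN; exists (- expR (complex.Re (clog z))).
  by rewrite /= oppr_le0 expR_ge0.
rewrite -[RHS]lE; case: (clog z) Epi => a b /= ->.
by rewrite cexpE cospi sinpi mulr0 mulrN1.
Qed.

(** After conjugation the partial sums are triangular with [exp_sum (d i)] on the diagonal, and both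
    facts survive the limit with the same [P] and the same order. *)
Lemma trig_by_expm P X d : trig_by P X d -> trig_by P (expm X) (fun i => cexp (d i)).
Proof.
move=> [Pu Xt Xd]; rewrite /trig_by -expm_conj //; split; first exact: Pu.
  apply/is_trig_mxP => i j ij; apply: cvg_scalar_unique (@cvg_expm _ _ _ i j) _.
  rewrite (_ : (fun N => _) = cst 0); first exact: cvg_cst.
  apply/funext => N; rewrite (expm_sum_trig N Xt (ltnW ij)).
  by rewrite -val_eqE ltn_eqF.
move=> i; apply: cvg_scalar_unique (@cvg_expm _ _ _ i i) _.
rewrite (_ : (fun N => _) = exp_sum (d i)); first exact: cvg_cexp.
by apply/funext => N; rewrite (expm_sum_trig N Xt (leqnn i)) eqxx Xd.
Qed.

Lemma trig_by_uniq P X d e i : trig_by P X d -> trig_by P X e -> d i = e i.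
Proof. by move=> [_ _ dE] [_ _ eE]; rewrite -dE eE. Qed.

Lemma trig_by_eqfun P X d e : (forall i, d i = e i) -> trig_by P X d -> trig_by P X e.
Proof. by move=> /funext ->. Qed.

Lemma trig_by_nilpotent_diag P X d m i : trig_by P X d -> X ^+ m = 0 -> d i = 0.
Proof.
move=> Xd Xm; have [_ _ /(_ i)] := trig_byX m Xd.
rewrite Xm mulr0 mul0r mxE => /esym/eqP; rewrite expf_eq0 => /andP[_ /eqP].
exact.
Qed.

Lemma expm_nilpotent_eq1 X m : X ^+ m = 0 -> expm X = 1 -> X = 0.
Proof.
move=> Xm; have Xm2 : X ^+ m.+2 = 0 by rewrite -addn2 exprD Xm mul0r.
by rewrite (expm_nilpotent Xm2); exact: expm_sum_nilpotent_eq1.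
Qed.

Lemma expm_inj_strip X Y : X * Y = Y * X ->
  (forall z, spectrum X z -> - pi < complex.Im z < pi) ->
  (forall z, spectrum Y z -> - pi < complex.Im z < pi) ->
  expm X = expm Y -> X = Y.
Proof.
move=> XY Xpi Ypi eXY; have [P [d [e [Xd Ye]]]] := cotrigonalization_by XY.
have dE i : d i = e i.
  have lt2 (z : C) : - pi < complex.Im z < pi -> - pi < complex.Im z <= pi.
    by move=> /andP[-> /ltW].
  apply: cexp_inj_strip.
  - by apply/lt2/Xpi/(trig_by_eigenvalue _ Xd); exists i.
  - by apply/lt2/Ypi/(trig_by_eigenvalue _ Ye); exists i.
  apply: (trig_by_uniq (e := fun i => cexp (e i)) i (trig_by_expm Xd)).
  by rewrite eXY; exact: trig_by_expm.
have Dt : trig_by P (X - Y) (fun=> 0).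
  by apply: trig_by_eqfun (trig_byD Xd (trig_byN Ye)) => i; rewrite dE subrr.
apply/eqP; rewrite -subr_eq0; apply/eqP.
apply: (expm_nilpotent_eq1 (trig_by_nilpotent Dt)).
rewrite expmD; last by rewrite mulrN XY mulNr.
rewrite eXY -expmD; last by rewrite mulrN mulNr.
by rewrite subrr expm0.
Qed.

Lemma interpolation (K : fieldType) (f : K -> K) (s : seq K) :
  exists p : {poly K}, {in s, forall x, p.[x] = f x}.
Proof.
elim: s => [|a s [p pE]]; first by exists 0.
have [sa|sa] := boolP (a \in s).
  by exists p => x; rewrite inE => /predU1P[->|]; exact: pE.
pose q := \prod_(b <- s) ('X - b%:P).
have qa : q.[a] != 0 by rewrite -/(root q a) root_prod_XsubC.
(* Newton interpolation: [q] vanishes at the old nodes but not at [a], so a multiple of it corrects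
   the value at [a] alone. *)
exists (p + ((f a - p.[a]) / q.[a]) *: q) => x.
rewrite inE !hornerE => /predU1P[->|xs]; first by rewrite divfK // addrC subrK.
by have /rootP -> : root q x; rewrite ?root_prod_XsubC // mulr0 addr0 pE.
Qed.

(* Newton's iteration for [expm Y = A]: if [M := A * expm (- Y) - 1] is the defect
   of [Y], then the defect of [Y + M] is a multiple of [M ^+ 2]. *)
Lemma newton_log A m Y :
  (forall Z, Z * A = A * Z -> Z * Y = Y * Z) ->
  (forall z, spectrum Y z -> - pi < complex.Im z < pi) ->
  (A * expm (- Y) - 1) ^+ m = 0 ->
  exists X, is_principal_log A X /\ forall Z, Z * A = A * Z -> Z * X = X * Z.
Proof.
elim: m Y => [|m IHm] Y Yc Ypi.
  (* The zeroth power is 1, so here [1 = 0] and all matrices coincide. *)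
  move=> eq10; exists Y; split=> //; split=> //.
  have z0 X : X = 0 by rewrite -[X]mulr1 -(expr0 (A * expm (- Y) - 1)) eq10 mulr0.
  exact: etrans (z0 _) (esym (z0 _)).
set M := _ - 1 => Mm.
have AY : Y * A = A * Y by rewrite (Yc A).
have comZM Z : Z * A = A * Z -> Z * M = M * Z.
  move=> ZA; rewrite mulrBr mulrBl mulr1 mul1r mulrA ZA -!mulrA.
  congr (_ * _ - _); apply: comm_expm.
  by rewrite mulrN mulNr Yc.
have MY : Y * M = M * Y by exact: comZM.
case: m IHm Mm => [|m] IHm Mm.
  exists Y; split=> //; split=> //.
  move: Mm; rewrite expr1 => /eqP; rewrite subr_eq0 => /eqP AE.
  by rewrite -[RHS]mulr1 -(expmN_mul Y) mulrA AE mul1r.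
have [P [d [e [Yd Me]]]] := cotrigonalization_by MY.
apply: (IHm (Y + M)) => [Z ZA|z|].
- by rewrite mulrDr mulrDl Yc // comZM.
(* The defect [M] is nilpotent and commutes with [Y], so adding it leaves the eigenvalues in the
   strip. *)
- move=> /(trig_by_eigenvalue _ (trig_byD Yd Me))[i ->].
  rewrite (trig_by_nilpotent_diag i Me Mm) addr0.
  by apply/Ypi/(trig_by_eigenvalue _ Yd); exists i.
rewrite opprD expmD; last by rewrite mulrNN MY mulrNN.
have NMm : (- M) ^+ m.+4 = 0.
  by rewrite exprNn -[X in M ^+ X](addn2 m.+2) [M ^+ _]exprD Mm mul0r mulr0.
have [Q [QM QE]] := expm_sum_newton M m.+2.
rewrite mulrA (_ : A * expm (- Y) = 1 + M); last by rewrite addrC subrK.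
rewrite (expm_nilpotent NMm) QE exprMn_comm; last by apply/commr_sym/commrX.
(* The new defect raised to [m.+1] contains [M ^+ (2 * m.+1)], which has the factor [M ^+ m.+2 = 0];
   the nilpotency exponent thus drops by at least one. *)
by rewrite -exprM mul2n -addnn addnS [M ^+ _](exprD M m.+2 m) Mm !mul0r.
Qed.

Lemma principal_log_exists A : (forall z, spectrum A z -> ~ nonpos_reals R z) ->
  exists X, is_principal_log A X /\ forall Z, Z * A = A * Z -> Z * X = X * Z.
Proof.
move=> hA; have [P [d [_ [Ad _]]]] := cotrigonalization_by (erefl (A * A)).
have [p pE] := interpolation (@clog R) [seq d i | i : 'I_n].
have {}pE i : p.[d i] = clog (d i) by apply: pE; apply: map_f; rewrite mem_enum.
have clogd i : cexp (clog (d i)) = d i /\ - pi < complex.Im (clog (d i)) < pi.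
  by apply/clog_lt_pi/hA/(trig_by_eigenvalue _ Ad); exists i.
have Yd := trig_by_eqfun pE (trig_by_horner p Ad).
set Y := \sum_(_ < _) _ in Yd.
apply: (@newton_log A n Y) => [Z ZA|z|].
- rewrite mulr_sumr mulr_suml; apply: eq_bigr => k _.
  by rewrite -!mulmxE -scalemxAr -scalemxAl !mulmxE; congr (_ *: _); exact: commrX.
- by move=> /(trig_by_eigenvalue _ Yd)[i ->]; exact: (clogd i).2.
apply: (@trig_by_nilpotent _ _ P).
(* The defect of [p(A)] has diagonal entries [d i * cexp (- clog (d i)) - 1 = 0], hence is
   nilpotent. *)
apply: trig_by_eqfun (trig_byD (trig_byM Ad (trig_by_expm (trig_byN Yd)))
  (trig_byN (trig_by1 _))) => [i|]; last by case: Ad.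
by rewrite -{1}(clogd i).1 mulrC cexpN_mul subrr.
Qed.

Lemma logm_spec A : (forall z, spectrum A z -> ~ nonpos_reals R z) ->
  is_principal_log A (logm A) /\ forall Z, Z * A = A * Z -> Z * logm A = logm A * Z.
Proof.
move=> hA; have [X [AX Xc]] := principal_log_exists hA.
have AL : is_principal_log A (logm A) by apply: xgetPex; exists X.
split=> //; suff -> : logm A = X by [].
have [[LA Lpi] [XA Xpi]] := (AL, AX).
(* [X] commutes with whatever commutes with [A], and [logm A] commutes with its own exponential
   [A]. *)
have LX : logm A * X = X * logm A.
  by apply: Xc; rewrite -[X in _ * X = _]LA -[X in _ = X * _]LA; exact: comm_expm.
exact: expm_inj_strip LX Lpi Xpi (etrans LA (esym XA)).
Qed.

Lemma spectrum_expm X z : spectrum (expm X) z <-> exists2 w, spectrum X w & z = cexp w.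
Proof.
have [P [d [_ [Xd _]]]] := cotrigonalization_by (erefl (X * X)).
split=> [/(trig_by_eigenvalue _ (trig_by_expm Xd))[i ->]|[w]].
  by exists (d i) => //; apply/(trig_by_eigenvalue _ Xd); exists i.
move=> /(trig_by_eigenvalue _ Xd)[i ->] ->.
by apply/(trig_by_eigenvalue _ (trig_by_expm Xd)); exists i.
Qed.

Lemma spectrum_expm_mulC X Y : spectrum (expm (X * Y)) = spectrum (expm (Y * X)).
Proof.
have sub (U V : 'M[C]_n) z : spectrum (expm (U * V)) z -> spectrum (expm (V * U)) z.
  move=> /(spectrum_expm (U * V))[w UVw ->]; apply/(spectrum_expm (V * U)).
  by exists w; [exact: eigenvalue_mulmxC | ].
by apply/seteqP; split=> z; exact: sub.
Qed.

End PrincipalLogarithm.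

Theorem lemma2p2 (R : realType) (n : nat) (A B : 'M[R[i]]_n)
    (hA : forall z : R[i], spectrum A z -> ~ nonpos_reals R z) :
  [/\ spectrum (mxpowr A B) = spectrum (mxpowl A B),
      A *m B = B *m A ->
        forall alpha beta : 'I_n -> R[i],
          eigenvalues_are A alpha -> eigenvalues_are B beta ->
          exists s t : 'S_n,
            let lam := fun k => cpow (alpha (s k)) (beta (t k)) in
            eigenvalues_are (mxpowr A B) lam /\
            eigenvalues_are (mxpowl A B) lam
    & B *m mxpowr A B = mxpowl A B *m B].
Proof.
split; last exact: expm_mulC.
  exact: spectrum_expm_mulC.
move=> AB alpha beta Aalpha Bbeta.
have [[LA Lpi] Lc] := logm_spec hA.
have BL : B * logm A = logm A * B by exact: Lc (esym AB).
have [P [d [e [Ld Be]]]] := cotrigonalization_by (esym BL).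
(* The same [P] triangularizes [A = expm (logm A)], with diagonal [cexp (d i)]; [s] and [t] match
   the given lists to the diagonals of [A] and [B]. *)
have Ad := trig_by_expm Ld; rewrite LA in Ad.
have [s sE] := perm_of_prod_XsubC (etrans (esym (trig_by_char_poly Ad)) Aalpha).
have [t tE] := perm_of_prod_XsubC (etrans (esym (trig_by_char_poly Be)) Bbeta).
(* The eigenvalues of [logm A] lie in the strip, so [d i] is the principal logarithm of its
   exponential and not another branch. *)
have clogd i : clog (alpha (s i)) = d i.
  rewrite -sE cexpK //; have /andP[-> /ltW ->] // : - pi < complex.Im (d i) < pi.
  by apply/Lpi/(trig_by_eigenvalue _ Ld); exists i.
have powE : eigenvalues_are (mxpowr A B)
    (fun k => cpow (alpha (s k)) (beta (t k))).
  apply: (@trig_by_char_poly _ _ P).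
  apply: trig_by_eqfun (trig_by_expm (trig_byM Ld Be)) => i.
  by rewrite /cpow clogd tE mulrC.
exists s, t; split; first exact: powE.
have <- : mxpowr A B = mxpowl A B := congr1 (@expm R n) (esym BL).
exact: powE.
Qed.
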